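(* Let $N$ be a Cox process directed by a non-decreasing additive process $\eta$, let $t>0$, and let $(T_j')$ be the non-ordered points of $N$ on $(0,t]$. Then for every $n\in\mathbb N$ and $t_1,\dots,t_n\in(0,t]$, $$\mathbb P(T_1'\le t_1,\dots,T_n'\le t_n,\ N(t)=n)=\frac1{n!}\,\mathbb E\Big[\prod_{j=1}^n\eta(t_j)\,e^{-\eta(t)}\Big].$$ Moreover, if $0=t_0<t_1\le t_2\le\cdots\le t_n\le t$ (which, since the $(T'_j)$ are iid non-ordered, is without loss of generality), this quantity equals $$\frac1{n!}\sum_{\substack{0\le k_j\le n+1-j-\sum_{i=j+1}^nk_i\ (1\le j\le n),\\ k_1+\cdots+k_n=n}}\ \prod_{j=1}^n\frac{(n+1-j-\sum_{i=j+1}^nk_i)!}{k_j!\,(n+1-j-\sum_{i=j}^nk_i)!}\ \mathbb E\big[\eta(t_{j-1},t_j]^{k_j}e^{-\eta(t_{j-1},t_j]}\big]\cdot\mathbb E\big[e^{-\eta(t_n,t]}\big],$$ where the factor $\mathbb E[e^{-\eta(t_n,t]}]$ appears once in each summand, the $k_j$ are non-negative integers, and if $t_{j-1}=t_j$ for some $j$ then one sets $k_j=0$ in this sum over $(k_1,\dots,k_n)$ and uses the convention $0^0=1$ in the factor $\eta(t_{j-1},t_j]^{k_j}$.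
   Context: For a process $X$ and $s\le t$, $X(s,t]:=X(t)-X(s)$. An additive process is a stochastically continuous process with independent increments and càdlàg paths, starting at $0$ a.s.; by the standing convention it has only a pure jump part, i.e. $\mathbb E[e^{ix\eta(u)}]=\exp\{\int_{(0,u]\times\mathbb R}(e^{ixv}-1)\rho(d(w,v))\}$ for a measure $\rho$ on $(0,\infty)\times\mathbb R$ with $\rho((0,\cdot]\times\{0\})=0$, $\rho(\{u\}\times\mathbb R)=0$ and $\int_{(0,u]\times\mathbb R}(|v|\wedge1)\rho(d(w,v))<\infty$ for all $u\ge 0$. A non-decreasing $\eta$ is identified with the random Lebesgue–Stieltjes measure it defines. A Cox process $N$ directed by $\eta$ is a counting process, $N(0)=0$, which conditionally on $\eta$ is a Poisson process with mean measure $\eta$ (independent increments, $N(s,t]$ Poisson with mean $\eta(s,t]$). Non-ordered points: conditionally on $\eta$ and $\{N(t)=n\}$, $(T_1',\dots,T_n')$ are the arrival times of $N$ in $(0,t]$ taken in non-ordered form, i.e. they are conditionally iid with common law $\eta(dx)/\eta(t)$, $0<x\le t$. *)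

(* Defs.v *)
From HB Require Import structures.
From mathcomp Require Import all_boot all_order all_algebra.
From mathcomp Require Import complex.
From mathcomp Require Import all_classical all_reals all_analysis.
From mathcomp Require Import measurable_realfun.
Set Implicit Arguments.
Unset Strict Implicit.
Unset Printing Implicit Defensive.
Import Order.TTheory GRing.Theory Num.Theory.
Import numFieldNormedType.Exports.
Local Open Scope classical_set_scope.
Local Open Scope ring_scope.

Definition cexp (R : realType) (z : R[i]) : R[i] :=
  Complex (expR (complex.Re z) * cos (complex.Im z))
          (expR (complex.Re z) * sin (complex.Im z)).

Definition cintegral (d : measure_display) (T : measurableType d)
    (R : realType) (mu : {measure set T -> \bar R}) (D : set T)
    (f : T -> R[i]) : R[i] :=
  Complex (\int[mu]_(x in D) complex.Re (f x))
          (\int[mu]_(x in D) complex.Im (f x)).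

(* Time runs over [0, +oo[: a process is a map X : R -> T -> R of which only
   the values X u with 0 <= u are meaningful. *)

Definition cadlag (R : realType) (f : R -> R) : Prop :=
  (forall u, 0 <= u -> f v @[v --> u^'+] --> f u) /\
  (forall u, 0 < u -> cvg (f v @[v --> u^'-])).

Section additive.
Context (d : measure_display) (T : measurableType d) (R : realType).
Implicit Types (P : probability T R) (X : R -> T -> R).

Definition stochastically_continuous P X : Prop :=
  forall u e : R, 0 <= u -> 0 < e ->
    P [set w | e < `|X v w - X u w|]
      @[v --> within [set v : R | 0 <= v] (nbhs u)] --> 0%E.

Definition independent_increments P X : Prop :=
  forall (m : nat) (s : nat -> R) (B : nat -> set R),
    0 <= s 0%N -> (forall i, s i <= s i.+1) ->
    (forall i, measurable (B i)) ->
    P [set w | forall i, (i < m)%N -> B i (X (s i.+1) w - X (s i) w)] =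
    (\prod_(i < m) P [set w | B i (X (s i.+1) w - X (s i) w)%R])%E.

(* [rho] is given on R * R, but only its restriction to ]0, +oo[ * R is
   constrained or used. *)
Definition pure_jump P X (rho : {measure set (R * R) -> \bar R}) : Prop :=
  [/\ forall u : R, 0 <= u -> rho (`]0, u] `*` [set 0]) = 0%E,
      forall u : R, 0 < u -> rho ([set u] `*` setT) = 0%E,
      forall u : R, 0 <= u ->
        (\int[rho]_(p in `]0%R, u] `*` setT)
           (Num.min `|p.2| 1)%:E < +oo)%E &
      forall u x : R, 0 <= u ->
        cintegral P setT (fun w => cexp (Complex 0 (x * X u w))) =
        cexp (cintegral rho (`]0%R, u] `*` setT)
                (fun p => cexp (Complex 0 (x * p.2)) - 1))].

Definition additive_process P X : Prop :=
  [/\ forall u, 0 <= u -> measurable_fun setT (X u),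
      (forall w, cadlag (X ^~ w)) /\ P [set w | X 0 w = 0] = 1%E,
      stochastically_continuous P X,
      independent_increments P X &
      exists rho, pure_jump P X rho].

Definition nondecreasing_paths X : Prop :=
  forall (w : T) (u v : R), 0 <= u -> u <= v -> X u w <= X v w.

End additive.

Record nd_additive (d : measure_display) (T : measurableType d)
    (R : realType) (P : probability T R) := NdAdditive {
  nd_process :> R -> T -> R ;
  nd_additiveP : additive_process P nd_process ;
  nd_nondecreasing : nondecreasing_paths nd_process }.

Section path_measure.
Context (d : measure_display) (T : measurableType d) (R : realType)
  (P : probability T R) (eta : nd_additive P).

(* The path of [eta] at [w], extended to negative times by its value at 0. *)
Definition path_of (w : T) (u : R) : R := eta (Num.max 0 u) w.

Lemma path_of_nondecreasing w : nondecreasing (path_of w).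
Proof.
move=> u v uv; apply: (nd_nondecreasing eta); first by rewrite le_max lexx.
by rewrite ge_max !le_max lexx uv orbT.
Qed.

Lemma path_of_right_continuous w : right_continuous (path_of w).
Proof.
move=> u; rewrite /path_of.
have [_ [/(_ w)[rc _] _] _ _ _] := nd_additiveP eta.
have [u0|u0] := leP 0 u.
- apply: cvg_trans (rc u u0); apply: near_eq_cvg.
  near=> v; rewrite max_r//; apply: le_trans u0 _; apply: ltW.
  by near: v; exact: nbhs_right_gt.
- apply: (@cvg_trans _ (eta 0 w @[_ --> u^'+])); last exact: cvg_cst.
  apply: near_eq_cvg; near=> v; rewrite max_l//; apply: ltW.
  by near: v; exact: nbhs_right_lt.
Unshelve. all: end_near. Qed.

HB.instance Definition _ (w : T) := isCumulative.Build R _ R (path_of w)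
  (@path_of_nondecreasing w) (@path_of_right_continuous w).

(* It has no mass on ]-oo, 0], so it is the measure that eta(., w) defines
   on ]0, +oo[. *)
Definition path_measure (w : T) : set R -> \bar R :=
  lebesgue_stieltjes_measure (path_of w).

End path_measure.

Section cox.
Context (d : measure_display) (T : measurableType d) (R : realType)
  (P : probability T R).

Definition sigma_of (X : R -> T -> R) : set (set T) :=
  <<s [set A | exists (u : R) (B : set R),
           [/\ 0 <= u, measurable B & A = X u @^-1` B]] >>.

(* [f] is a version of the conditional probability of [E] given the
   sigma-algebra [G] and the event [C], that is, of the conditional
   probability of [E] given [G] under P( . | C): the factor P(C) has been
   cancelled on both sides. *)
Definition cond_prob_version (G : set (set T)) (C E : set T)
    (f : T -> \bar R) : Prop :=
  (forall B : set (\bar R), measurable B -> G (f @^-1` B)) /\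
  (forall A, G A ->
     P (A `&` C `&` E) = (\int[P]_(w in A `&` C) f w)%E).

(* Several points may occur at the same time, as [eta] may jump, so the
   jumps of a counting process need not have size 1. *)
Definition counting_process (N : R -> T -> nat) : Prop :=
  [/\ forall u, 0 <= u -> measurable_fun setT (N u),
      forall w, N 0 w = 0%N,
      forall w u v, 0 <= u -> u <= v -> (N u w <= N v w)%N &
      forall w, cadlag (fun u => (N u w)%:R : R)].

(* [poisson_prob r _] is the Poisson law of mean r, the Dirac mass at 0 when
   r = 0; the library leaves its second argument unused. *)
Definition cox_process (eta : nd_additive P) (N : R -> T -> nat) : Prop :=
  counting_process N /\
  forall (m : nat) (s : nat -> R) (K : nat -> set nat),
    0 <= s 0%N -> (forall i, s i <= s i.+1) ->
    cond_prob_version (sigma_of eta) setT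
      [set w | forall i, (i < m)%N -> K i (N (s i.+1) w - N (s i) w)%N]
      (fun w => \prod_(i < m)
                  poisson_prob (eta (s i.+1) w - eta (s i) w)%R 0 (K i))%E.

(* [T' j] stands for T'_{j+1}; it is meaningful on {N(t) > j} only.
   The quotient below is 0 when eta(t) = 0; then N(t) = 0 a.s. *)
Definition nonordered_points (eta : nd_additive P) (N : R -> T -> nat)
    (t : R) (T' : nat -> T -> R) : Prop :=
  [/\ forall j, measurable_fun [set w | (j < N t w)%N] (T' j),
      forall w j, (j < N t w)%N -> 0 < T' j w <= t,
      forall w s, 0 <= s -> s <= t ->
        N s w = (\sum_(j < N t w) (T' j w <= s)%R)%N &
      forall (n : nat) (B : nat -> set R), (forall j, measurable (B j)) ->
        cond_prob_version (sigma_of eta) [set w | N t w = n]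
          [set w | forall j, (j < n)%N -> B j (T' j w)]
          (fun w => \prod_(j < n)
             (path_measure eta w (B j `&` `]0%R, t]) * ((eta t w)^-1)%:E))%E].

End cox.

(* With k_{j+1} encoded as [k j], j : 'I_n, [avail k j] is
   n + 1 - (j+1) - sum_(i > j+1) k_i.  The truncated subtraction is harmless:
   the constraints at the larger indices make this difference nonnegative. *)
Definition avail (n : nat) (k : {ffun 'I_n -> 'I_n.+1}) (j : 'I_n) : nat :=
  (n - j - \sum_(i < n | (j < i)%N) k i)%N.

(* Here [tt] is not shifted: [tt j] is t_j for 0 <= j <= n. *)
Definition admissible (R : realType) (n : nat) (tt : nat -> R)
    (k : {ffun 'I_n -> 'I_n.+1}) : bool :=
  [&& [forall j, (k j <= avail k j)%N],
      (\sum_(j < n) k j == n)%N &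
      [forall j : 'I_n, (tt j == tt j.+1) ==> (k j == 0%N :> nat)]].

(* Main.v *)
(* Given eta, the event has conditional probability
   (prod_j eta(t_j) / eta(t)^n) * (eta(t)^n / n!) e^(-eta(t)): the first factor
   is the conditional probability of the T'_j <= t_j given N(t) = n, the second
   the Poisson probability of N(t) = n. For ordered times, write each eta(t_j)
   as a sum of increments and expand the product, distributing the factors over
   the increments starting from the last one: eta(t_(i-1), t_i] occurs only in
   the factors j >= i, which yields the binomial coefficients. The increments
   being independent, the expectation of each monomial factorizes. *)
Require Import Defs.
From HB Require Import structures.
From mathcomp Require Import all_boot all_order all_algebra.
From mathcomp Require Import all_classical all_reals all_analysis.
From mathcomp Require Import measurable_realfun.
From mathcomp Require Import zify.
Set Implicit Arguments.
Unset Strict Implicit.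
Unset Printing Implicit Defensive.
Import Order.TTheory GRing.Theory Num.Theory.
Import numFieldNormedType.Exports.
Local Open Scope classical_set_scope.
Local Open Scope ring_scope.

(** * Expansion of a product of partial sums *)

Definition ffun_rcons (I : Type) m (k : {ffun 'I_m -> I}) (c : I) :
    {ffun 'I_m.+1 -> I} :=
  [ffun j => if unlift ord_max j is Some i then k i else c].

Lemma ffun_rcons_max (I : Type) m (k : {ffun 'I_m -> I}) c :
  ffun_rcons k c ord_max = c.
Proof. by rewrite ffunE unlift_none. Qed.

Lemma ffun_rcons_widen (I : Type) m (k : {ffun 'I_m -> I}) c j :
  ffun_rcons k c (widen_ord (leqnSn m) j) = k j.
Proof.
have -> : widen_ord (leqnSn m) j = lift ord_max j.
  by apply: val_inj; rewrite /= /bump leqNgt ltn_ord.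
by rewrite ffunE liftK.
Qed.

(** [ffun_rcons] is a bijection from pairs to tuples, so the last exponent can be summed separately;
    the expansion below peels off the last increment in this way. *)
Lemma big_ffun_ord_recr (A : nmodType) (I : finType) m
    (F : {ffun 'I_m.+1 -> I} -> A) :
  \sum_k F k = \sum_(k : {ffun 'I_m -> I}) \sum_c F (ffun_rcons k c).
Proof.
rewrite pair_big /=.
rewrite (reindex (fun p : {ffun 'I_m -> I} * I => ffun_rcons p.1 p.2)) //=.
exists (fun k : {ffun 'I_m.+1 -> I} =>
  ([ffun i => k (lift ord_max i)], k ord_max)) => [[k c]|k] _ /=.
  congr pair; first by apply/ffunP => i; rewrite !ffunE liftK.
  exact: ffun_rcons_max.
by apply/ffunP => j; rewrite ffunE; case: unliftP => [i|] ->; rewrite ?ffunE.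
Qed.

(* [avail] with [a] additional factors, each containing all [m] increments. *)
Definition slots m a (I : nat) (k : {ffun 'I_m -> 'I_I}) (j : 'I_m) : nat :=
  (m + a - j - \sum_(i < m | (j < i)%N) k i)%N.

Lemma slots_rcons_max m a I (k : {ffun 'I_m -> 'I_I}) c :
  slots a (ffun_rcons k c) ord_max = a.+1.
Proof.
rewrite /slots big1; last by move=> i; rewrite ltnNge -ltnS ltn_ord.
by rewrite subn0 /= addSnnS addKn.
Qed.

(** Of the [a.+1] factors containing the last increment, [c] select it. The other [a.+1 - c] must
    select earlier increments, so they act as additional factors for the shorter tuple. *)
Lemma slots_rcons_widen m a I (k : {ffun 'I_m -> 'I_I}) (c : 'I_I) j :
  (c <= a.+1)%N ->
  slots a (ffun_rcons k c) (widen_ord (leqnSn m) j) = slots (a.+1 - c) k j.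
Proof.
move=> ca; rewrite /slots big_mkcond big_ord_recr /= ltn_ord ffun_rcons_max.
rewrite -big_mkcond /=.
under eq_bigr do rewrite ffun_rcons_widen.
have := ltn_ord j; lia.
Qed.

(* The extra power makes the induction go through: expanding the power a+1 of
   the last partial sum leaves a power of the preceding one. *)
Lemma prod_partial_sums (A : comNzRingType) (x : nat -> A) n m a :
  (m + a <= n)%N ->
  (\prod_(j < m) \sum_(i < j.+1) x i) * (\sum_(i < m) x i) ^+ a =
  \sum_(k : {ffun 'I_m -> 'I_n.+1} | (\sum_(j < m) k j == m + a)%N)
    \prod_(j < m) ('C(slots a k j, k j)%:R * x j ^+ k j).
Proof.
elim: m a => [|m IHm] a.
  (* There is a single empty tuple, and both sides are 1 or 0 according to whether [a] is 0. *)
  move=> _; rewrite big_ord0 mul1r big_ord0 expr0n.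
  under eq_bigl do rewrite big_ord0 add0n eq_sym.
  under eq_bigr do rewrite big_ord0.
  rewrite sumr_const; congr (_%:R); case: eqP => a0.
    rewrite (@eq_card _ _ predT) ?cardT; last by move=> k; rewrite inE a0.
    by rewrite -cardT card_ffun !card_ord expn0.
  by rewrite (@eq_card0) // => k; rewrite inE; apply/eqP.
move=> man; rewrite [RHS]big_mkcond big_ffun_ord_recr exchange_big /=.
(* The last factor of the product joins the extra power, which becomes [a.+1] and is expanded by the
   binomial theorem. The range [c <= a.+1] of that expansion is then widened to [c <= n], the range
   of the exponents. *)
rewrite big_ord_recr /= -mulrA -exprS.
rewrite [in X in _ * X]big_ord_recr /= exprDn mulr_sumr.
rewrite (big_ord_widen n.+1 (fun c : nat =>
  (\prod_(i < m) \sum_(j < i.+1) x j) *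
  ((\sum_(i < m) x i) ^+ (a.+1 - c) * x m ^+ c *+ 'C(a.+1, c)))); last by lia.
rewrite big_mkcond; apply: eq_bigr => c _; case: ifPn => ca; last first.
  (* For [c > a.+1] the binomial coefficient of the last increment vanishes. *)
  rewrite big1// => k _; case: ifPn => // _.
  rewrite big_ord_recr /= ffun_rcons_max slots_rcons_max bin_small; last by lia.
  by rewrite mul0r mulr0.
have {}ca : (c <= a.+1)%N by lia.
rewrite -mulr_natl mulrCA [X in _ * X]mulrA IHm; last by lia.
rewrite mulr_suml mulr_sumr [LHS]big_mkcond; apply: eq_bigr => k _.
rewrite !big_ord_recr /= !ffun_rcons_max slots_rcons_max.
under [in RHS]eq_bigr do rewrite ffun_rcons_widen.
have -> : (\sum_(i < m) k i + c == m.+1 + a)%N =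
          (\sum_(j < m) k j == m + (a.+1 - c))%N by apply/eqP/eqP; lia.
case: ifP => // _.
under [in RHS]eq_bigr do rewrite slots_rcons_widen// ffun_rcons_widen.
by rewrite mulrCA.
Qed.

(** The terms that admissibility excludes are zero: the binomial coefficient vanishes when [k j]
    exceeds [avail k j], and [x j ^+ k j] vanishes when [k j] is positive on an empty interval. *)
Lemma prod_partial_sums_admissible (R : realType) n (tt x : nat -> R) :
  (forall j, (j < n)%N -> tt j = tt j.+1 -> x j = 0) ->
  \prod_(j < n) \sum_(i < j.+1) x i =
  \sum_(k : {ffun 'I_n -> 'I_n.+1} | admissible tt k)
    \prod_(j < n) ((avail k j)`!%:R / ((k j)`!%:R * (avail k j - k j)`!%:R) *
                   x j ^+ k j).
Proof.
move=> x0.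
have := @prod_partial_sums R x n n 0 (eq_leq (addn0 n)).
rewrite expr0 mulr1 addn0 => ->.
rewrite big_mkcond [RHS]big_mkcond; apply: eq_bigr => k _.
rewrite /admissible; case: eqP => [_|]; last by rewrite andbF.
have slotsE j : slots 0 k j = avail k j by rewrite /slots addn0.
under eq_bigr do rewrite slotsE.
case: (boolP [forall j, _]) => [/forallP kle|/forallPn[j kj]] /=; last first.
  by rewrite (bigD1 j)//= bin_small ?mul0r// ltnNge.
case: (boolP [forall j, _]) => [_|/forallPn[j]] /=; last first.
  rewrite negb_imply => /andP[/eqP ttj kj].
  by rewrite (bigD1 j)//= x0// expr0n (negbTE kj) mulr0 mul0r.
apply: eq_bigr => j _; congr (_ * _).
by rewrite -natrM -(bin_fact (kle j)) natrM mulfK// pnatr_eq0.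
Qed.

(** * Integrals weighted by a function of a random element *)

Section integral_comp_mul.
Context (d d' : measure_display) (T : measurableType d) (Y : measurableType d')
  (R : realType) (mu : {measure set T -> \bar R}) (X : T -> Y).
Hypothesis mX : measurable_fun setT X.
Implicit Types (u v : T -> \bar R) (h : Y -> \bar R).
Local Open Scope ereal_scope.
Import HBNNSimple.

Let integral_comp_mul_nnsfun u (h : {nnsfun Y >-> R}) :
  measurable_fun setT u -> (forall w, 0 <= u w) ->
  \int[mu]_w ((h (X w))%:E * u w) =
  \sum_(y \in range h) (y%:E * \int[mu]_(w in X @^-1` (h @^-1` [set y])) u w).
Proof.
move=> mu_ u0.
have mI y : measurable (X @^-1` (h @^-1` [set y])).
  by rewrite -[X in measurable X]setTI; apply: mX.
transitivity (\int[mu]_w \sum_(y \in range h)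
    (y%:E * (\1_(h @^-1` [set y]) (X w))%:E * u w)).
  apply: eq_integral => w _; rewrite -ge0_mule_fsuml; last first.
    by move=> y; exact: nnfun_muleindic_ge0.
  by rewrite fimfunE -fsumEFin.
rewrite ge0_integral_fsum//; last 2 first.
- move=> y; apply: emeasurable_funM => //; apply: measurable_funeM.
  by apply/measurable_EFinP; apply: measurableT_comp.
- by move=> y w _; rewrite mule_ge0// nnfun_muleindic_ge0.
apply: eq_fsbigr => y; rewrite inE => -[z _ <-].
rewrite [in RHS]integral_mkcond (epatch_indic (fun w => u w)).
rewrite -ge0_integralZl//; last 3 first.
- apply: emeasurable_funM => //; apply/measurable_EFinP.
  exact: measurable_indic.
- by move=> w _ /=; rewrite mule_ge0// lee_fin.
- by rewrite lee_fin.
by apply: eq_integral => w _; rewrite /= -muleA; congr (_ * _); rewrite muleC.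
Qed.

Let integral_comp_mul_lim u h :
  measurable_fun setT u -> (forall w, 0 <= u w) ->
  forall (mh : measurable_fun setT h), (forall y, 0 <= h y) ->
  \int[mu]_w (h (X w) * u w) =
  limn (fun k => \int[mu]_w ((nnsfun_approx measurableT mh k (X w))%:E * u w)).
Proof.
move=> mu_ u0 mh h0; rewrite -monotone_convergence//; last 3 first.
- move=> k; apply: emeasurable_funM => //; apply/measurable_EFinP.
  exact: measurableT_comp.
- by move=> k w _; rewrite mule_ge0// lee_fin.
- move=> w _ i j ij; rewrite lee_wpmul2r// lee_fin.
  exact/lefP/nd_nnsfun_approx.
apply: eq_integral => w _; apply/esym/cvg_lim => //.
have hc := cvg_nnsfun_approx measurableT mh (fun y _ => h0 y)
  (I : [set: Y] (X w)).
(* Products of 0 and an infinite value escape continuity of multiplication, so zero factors are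
   treated apart. Where [h (X w)] is zero, so are its approximations from below. *)
have [->|uw0] := eqVneq (u w) 0.
  by rewrite mule0; under eq_fun do rewrite mule0; exact: cvg_cst.
have [hX0|hX0] := eqVneq (h (X w)) 0; last first.
  by apply: cvgeM hc (cvg_cst _); rewrite neq0_mule_def// mule_neq0.
rewrite hX0 mul0e; apply: cvg_near_cst; apply: nearW => k.
suff -> : nnsfun_approx measurableT mh k (X w) = 0%R by rewrite mul0e.
apply/le_anti; rewrite fun_ge0 andbT -lee_fin nnsfun_approxE.
by rewrite (le_trans (le_approx _ (fun y _ => h0 y) _))// hX0.
Qed.

(** Simple functions of [X] involve only integrals over preimages under [X], and monotone
    convergence passes to general [h]. This serves both to replace indicators by functions under
    independence and to condition under the integral. *)
Lemma eq_integral_comp_mul u v h :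
  measurable_fun setT u -> (forall w, 0 <= u w) ->
  measurable_fun setT v -> (forall w, 0 <= v w) ->
  measurable_fun setT h -> (forall y, 0 <= h y) ->
  (forall B, measurable B ->
    \int[mu]_(w in X @^-1` B) u w = \int[mu]_(w in X @^-1` B) v w) ->
  \int[mu]_w (h (X w) * u w) = \int[mu]_w (h (X w) * v w).
Proof.
move=> mu_ u0 mv v0 mh h0 uv; rewrite !(integral_comp_mul_lim _ _ mh)//.
congr (limn _); apply/funext => k; rewrite !integral_comp_mul_nnsfun//.
by apply: eq_fsbigr => y _; rewrite uv.
Qed.

End integral_comp_mul.

(** * Expectation of a product of independent factors *)

Lemma emeasurable_prod (d : measure_display) (T : measurableType d)
    (R : realType) (D : set T) (I : Type) (r : seq I) (Q : pred I)
    (f : I -> T -> \bar R) : measurable D ->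
  (forall i, measurable_fun D (f i)) ->
  measurable_fun D (fun w => \prod_(i <- r | Q i) f i w)%E.
Proof.
move=> mD mf; under eq_fun do rewrite -big_filter.
elim: [seq i <- r | Q i] => [|i s IHs].
  by under eq_fun do rewrite big_nil; exact: measurable_cst.
by under eq_fun do rewrite big_cons; exact: emeasurable_funM.
Qed.

Lemma prod_indic (R : realType) (T : Type) m (A : nat -> set T) (w : T) :
  (\prod_(i < m) (\1_(A i) w)%:E =
   (\1_[set w | forall i, (i < m)%N -> A i w] w)%:E :> \bar R)%E.
Proof.
rewrite [in RHS]indicE; case: (boolP (w \in _)) => [|].
  rewrite inE => /= Aw; apply: big1 => i _.
  by rewrite indicE mem_set//; exact: Aw.
rewrite notin_setE => /existsNP[i /not_implyP[im Aiw]].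
by rewrite (bigD1 (Ordinal im))//= indicE memNset// mul0e.
Qed.

(* The indicators are replaced by arbitrary functions one at a time. *)
Lemma integral_prod_independent (d d' : measure_display) (T : measurableType d)
    (S : measurableType d') (R : realType) (P : probability T R) m
    (Y : nat -> T -> S) (g : nat -> S -> \bar R) :
  (forall i, measurable_fun setT (Y i)) ->
  (forall B : nat -> set S, (forall i, measurable (B i)) ->
    P [set w | forall i, (i < m)%N -> B i (Y i w)] =
    (\prod_(i < m) P (Y i @^-1` B i))%E) ->
  (forall i, measurable_fun setT (g i)) -> (forall i y, (0 <= g i y)%E) ->
  (\int[P]_w \prod_(i < m) g i (Y i w) = \prod_(i < m) \int[P]_w g i (Y i w))%E.
Proof.
move=> mY indep mg0 g00.
(* Induction on [k <= m], for families whose members of index at least [k] are indicators: at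
   [k = m] this is no restriction, and at [k = 0] the claim is the hypothesis on events. *)
have : forall i, (m <= i < m)%N -> exists2 B, measurable B & g i = EFin \o \1_B.
  by move=> i; rewrite leqNgt andNb.
have : (m <= m)%N by [].
have mI i B : measurable B -> measurable (Y i @^-1` B).
  by move=> mB; rewrite -[X in measurable X]setTI; exact: mY.
move: {1 3}m => k; elim: k => [|k IHk] in g mg0 g00 *.
  move=> _ gB.
  have /choice[B HB] : forall i, exists B : set S,
      measurable B /\ ((i < m)%N -> g i = EFin \o \1_B).
    move=> i; have [/gB[B mB gE]|_] := ltnP i m; first by exists B.
    by exists setT.
  have gE (i : 'I_m) w : g i (Y i w) = (\1_(Y i @^-1` B i) w)%:E.
    by rewrite (HB i).2.
  transitivity (\int[P]_w
      (\1_[set w | forall i, (i < m)%N -> B i (Y i w)] w)%:E)%E.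
    apply: eq_integral => w _.
    rewrite -(prod_indic R m (fun i => Y i @^-1` B i)).
    by apply: eq_bigr => i _; rewrite gE.
  rewrite integral_indic//; last first.
    rewrite (_ : [set w | _] = \bigcap_(i < m) (Y i @^-1` B i)) //.
    by apply: bigcap_measurableType => i _; apply: mI; exact: (HB i).1.
  rewrite setIT; apply: (etrans (indep B _)).
    by move=> i; exact: (HB i).1.
  apply: eq_bigr => i _; under eq_integral do rewrite gE.
  by rewrite integral_indic ?setIT//; apply: mI; exact: (HB i).1.
move=> km gB; pose K := Ordinal km.
(* The product [u] of the other factors is to be replaced by the constant [c], the product of their
   expectations. It suffices to compare integrals over the events that [Y k] lies in [B]. *)
pose u w := (\prod_(i < m | i != K) g i (Y i w))%E.
pose c := (\prod_(i < m | i != K) \int[P]_w g i (Y i w))%E.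
have u0 w : (0 <= u w)%E by apply: prode_ge0.
have c0 : (0 <= c)%E by apply: prode_ge0 => i _; exact: integral_ge0.
have mgY i : measurable_fun setT (fun w => g i (Y i w)).
  exact: measurableT_comp.
have mu : measurable_fun setT u by apply: emeasurable_prod.
under eq_integral do rewrite (bigD1 K)//= -/(u _).
rewrite (bigD1 K)//= -/c.
rewrite (@eq_integral_comp_mul _ _ _ _ _ P (Y k) (mY k) u (cst c) (g k))//.
  by rewrite ge0_integralZr.
move=> B mB.
(* With the indicator of [B] at index [k], the family falls under the induction hypothesis. *)
pose g' i := if i == k then EFin \o \1_B : S -> \bar R else g i.
have g'K w : g' k (Y k w) = (\1_(Y k @^-1` B) w)%:E by rewrite /g' eqxx.
have g'N (i : 'I_m) : i != K -> g' i = g i.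
  by move=> iK; rewrite /g' ifN.
have mg' i : measurable_fun setT (g' i).
  by rewrite /g'; case: ifP => // _; exact/measurable_EFinP/measurable_indic.
have g'0 i y : (0 <= g' i y)%E.
  by rewrite /g'; case: ifP => // _; rewrite lee_fin.
rewrite integral_cst; last exact: mI.
rewrite muleC integral_mkcond epatch_indic.
transitivity (\int[P]_w \prod_(i < m) g' i (Y i w))%E.
  apply: eq_integral => w _; rewrite (bigD1 K)//= g'K muleC; congr (_ * _)%E.
  by apply: eq_bigr => i iK; rewrite g'N.
rewrite IHk//; last 2 first.
- exact: ltnW.
- move=> i; rewrite leq_eqVlt /g' eq_sym; case: eqP => [_ _|_ /= /gB//].
  by exists B.
rewrite (bigD1 K)//=; congr (_ * _)%E.
  under eq_integral do rewrite g'K.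
  by rewrite integral_indic ?setIT//; exact: mI.
by apply: eq_bigr => i iK; rewrite g'N.
Qed.

(** * Conditional probabilities and Poisson weights *)

Lemma sigma_of_measurable (d : measure_display) (T : measurableType d)
    (R : realType) (X : R -> T -> R) :
  (forall u, 0 <= u -> measurable_fun setT (X u)) ->
  sigma_of X `<=` measurable.
Proof.
move=> mX; apply: smallest_sub; first exact: sigma_algebra_measurable.
move=> _ [u [B [u0 mB ->]]].
by rewrite -[X in measurable X]setTI; exact: mX.
Qed.

(** The probability is the integral of [f] times the indicator of [C]; as the preimages under [f]
    lie in [G], that indicator may be replaced by its conditional probability [g]. The truncation by
    [maxe] makes the weight nonnegative everywhere, whereas [f] is so only almost everywhere. *)
Lemma cond_prob_version_mul (d : measure_display) (T : measurableType d)
    (R : realType) (P : probability T R) (G : set (set T)) (C E : set T)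
    (f g : T -> \bar R) :
  G `<=` measurable -> G setT -> measurable C ->
  cond_prob_version P G C E f -> cond_prob_version P G setT C g ->
  (\forall w \ae P, (0 <= f w)%E) -> (forall w, (0 <= g w)%E) ->
  P (C `&` E) = (\int[P]_w (maxe (f w) 0 * g w))%E.
Proof.
move=> Gm GT mC [Gf fE] [Gg gE] f0 g0.
have mf : measurable_fun setT f.
  by move=> _ B mB; rewrite setTI; apply: Gm; exact: Gf.
have mg : measurable_fun setT g.
  by move=> _ B mB; rewrite setTI; apply: Gm; exact: Gg.
have mh : measurable_fun setT (fun y : \bar R => maxe y 0)%E.
  by apply: measurable_maxe; [exact: measurable_id|exact: measurable_cst].
have mhf : measurable_fun setT (fun w => maxe (f w) 0)%E.
  exact: (measurableT_comp mh mf).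
rewrite -(@eq_integral_comp_mul _ _ _ _ _ P f mf (EFin \o \1_C) g
  (fun y => maxe y 0)%E)//; first last.
- move=> B mB; have := gE _ (Gf _ mB); rewrite setIT => <-.
  rewrite integral_indic//; first by rewrite setIC.
  by apply: Gm; exact: Gf.
- by move=> y; rewrite le_max lexx orbT.
- by move=> w; rewrite lee_fin.
- exact/measurable_EFinP/measurable_indic.
have := fE _ GT; rewrite setTI => ->.
rewrite [LHS](ae_eq_integral (fun w => maxe (f w) 0)%E)//; last 3 first.
- exact: measurable_funTS.
- exact: measurable_funTS.
- by apply: filterS f0 => w f0 _; rewrite (elimT max_idPl).
by rewrite integral_mkcond epatch_indic.
Qed.

(** At [r = 0] the law is the Dirac mass at 0, and the formula persists because [0 ^+ 0 = 1]. *)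
Lemma poisson_prob_set1 (R : realType) (r : R) k n : 0 <= r ->
  poisson_prob r k [set n] = (n`!%:R^-1 * (r ^+ n * expR (- r)))%:E.
Proof.
rewrite le_eqVlt => /predU1P[<-|r0]; rewrite /poisson_prob.
  rewrite ltxx diracE expr0n oppr0 expR0 mulr1.
  case: n => [|n]; first by rewrite mem_set//= invr1 mulr1.
  by rewrite memNset ?mulr0.
rewrite r0 esum_set1 ?lee_fin ?poisson_pmf_ge0// /poisson_pmf r0.
by congr EFin; rewrite -mulrA mulrCA.
Qed.

(** * Initial value and path measure of the directing process *)

Section nd_additive_theory.
Context (d : measure_display) (T : measurableType d) (R : realType)
  (P : probability T R) (eta : nd_additive P).

Lemma measurable_nd_additive u : 0 <= u -> measurable_fun setT (eta u).
Proof. by have [+ _ _ _ _] := nd_additiveP eta; exact. Qed.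

Lemma nd_additive0_ae : \forall w \ae P, eta 0 w = 0.
Proof.
have [_ [_ P0] _ _ _] := nd_additiveP eta.
have m0 : measurable [set w | eta 0 w = 0].
  rewrite -[X in measurable X]setTI.
  exact: measurable_nd_additive (lexx 0) measurableT _ (measurable_set1 0).
exists (~` [set w | eta 0 w = 0]); split => //; first exact: measurableC.
by rewrite probability_setC// P0 subee.
Qed.

Lemma path_measure_itv w a b : 0 <= a -> a <= b ->
  path_measure eta w `]a, b] = (eta b w - eta a w)%:E.
Proof.
move=> a0 ab; rewrite /path_measure /lebesgue_stieltjes_measure.
rewrite /measure_extension/= measurable_mu_extE/=; last exact: is_ocitv.
by rewrite wlength_itv_bnd// /path_of !max_r// (le_trans a0).
Qed.

End nd_additive_theory.

(** * The law of the non-ordered points and its expansion over increments *)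

Section mixed_sample.
Context (d : measure_display) (T : measurableType d) (R : realType)
  (P : probability T R) (eta : nd_additive P) (t : R) (n : nat) (tt : nat -> R).
Hypotheses (t0 : 0 < t) (tt0 : tt 0%N = 0).
Hypothesis htt : forall j, (j < n)%N -> 0 < tt j.+1 <= t.

(* [eta 0] is subtracted so that the integrand is nonnegative everywhere, not
   only almost everywhere. *)
Let D u w : R := eta u w - eta 0 w.

Let D_ge0 u w : 0 <= u -> 0 <= D u w.
Proof. by move=> u0; rewrite subr_ge0; apply: (nd_nondecreasing eta). Qed.

Let mD u : 0 <= u -> measurable_fun setT (D u).
Proof.
by move=> u0; apply: measurable_funB; exact: measurable_nd_additive.
Qed.

Let G w : R := (\prod_(j < n) D (tt j.+1) w) * expR (- D t w).

Let G_ge0 w : 0 <= G w.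
Proof.
rewrite mulr_ge0 ?expR_ge0//; apply: prodr_ge0 => j _; apply: D_ge0.
by have /andP[/ltW] := htt (ltn_ord j).
Qed.

Let mG : measurable_fun setT G.
Proof.
apply: measurable_funM; last first.
  by apply: measurableT_comp => //; apply: measurableT_comp => //; exact/mD/ltW.
apply: measurable_prod => j _; apply: mD.
by have /andP[/ltW] := htt (ltn_ord j).
Qed.

(** Since [eta 0] vanishes almost everywhere, subtracting it does not affect the expectation. *)
Lemma expectation_prod_shift :
  ('E_P[fun w => ((\prod_(j < n) eta (tt j.+1) w) * expR (- eta t w))%R] =
   \int[P]_w (G w)%:E)%E.
Proof.
rewrite unlock; apply: ae_eq_integral => //.
- apply/measurable_EFinP; apply: measurable_funM; last first.
    apply: measurableT_comp => //; apply: measurableT_comp => //.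
    exact/measurable_nd_additive/ltW.
  apply: measurable_prod => j _; apply: measurable_nd_additive.
  by have /andP[/ltW] := htt (ltn_ord j).
- exact/measurable_EFinP.
apply: filterS (nd_additive0_ae eta) => w e0 _ /=.
rewrite /G /D e0 subr0; congr ((_ * _)%:E).
by apply: eq_bigr => j _; rewrite subr0.
Qed.

Lemma prob_nonordered_points (N : R -> T -> nat) (T' : nat -> T -> R) :
  cox_process eta N -> nonordered_points eta N t T' ->
  P [set w | (forall j, (j < n)%N -> (T' j w <= tt j.+1)%R) /\ N t w = n] =
  ((n`!%:R^-1)%:E * \int[P]_w (G w)%:E)%E.
Proof.
move=> [[mN N0 _ _] cox] [_ _ _ /(_ n (fun j => `]-oo, tt j.+1]%classic))].
move=> /(_ (fun j => measurable_itv _)) condT.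
(* A single increment, from 0 to [t], is enough: it equals [N t] because [N] starts at 0. *)
have condN := cox 1%N (fun i => if i is 0%N then 0 else t)
  (fun=> [set n]) (lexx 0).
have {}condN := condN (fun i => match i with 0%N => ltW t0 | _ => lexx t end).
rewrite (_ : [set w | forall i, _] = [set w | N t w = n]) in condN; last first.
  apply/seteqP; split => w /= => [/(_ 0%N isT)|Nt [|i]//]; rewrite N0 subn0//.
set f := (X in cond_prob_version _ _ _ _ X) in condT.
set g := (X in cond_prob_version _ _ _ _ X) in condN.
have eta_m := sigma_of_measurable (measurable_nd_additive eta).
have GT : sigma_of eta setT.
  rewrite -(setD0 setT) /sigma_of.
  have [G0 GC _] := smallest_sigma_algebra setT
    [set A | exists (u : R) (B : set R),
      [/\ 0 <= u, measurable B & A = eta u @^-1` B]].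
  exact: GC.
have mC : measurable [set w | N t w = n].
  rewrite -[X in measurable X]setTI.
  exact: (mN t (ltW t0)) measurableT [set n] _.
have gE w : g w = (n`!%:R^-1 * (D t w ^+ n * expR (- D t w)))%:E.
  by rewrite /g big_ord1 poisson_prob_set1//; exact: (D_ge0 w (ltW t0)).
have fE w : f w = (\prod_(j < n) (D (tt j.+1) w / eta t w))%:E.
  rewrite /f -prodEFin; apply: eq_bigr => j _.
  have /andP[/ltW tj0 tjt] := htt (ltn_ord j).
  rewrite EFinM; congr (_ * _)%E; rewrite -path_measure_itv//.
  congr path_measure; apply/seteqP; split => x /=; rewrite !in_itv/=.
    by move=> [xtj /andP[-> _]].
  by move=> /andP[-> xtj]; rewrite xtj (le_trans xtj).
rewrite (_ : [set w | _ /\ _] = [set w | N t w = n] `&`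
  [set w | forall j, (j < n)%N -> `]-oo, tt j.+1]%classic (T' j w)]);
  last first.
  by apply/seteqP; split => w /= [? ?]; split.
(* The divisor in [f] is [eta t], not [D t], so its sign is controlled where [eta 0] vanishes. *)
have f_ge0 w : eta 0 w = 0 -> (0 <= f w)%E.
  move=> e0; rewrite fE lee_fin; apply: prodr_ge0 => j _.
  have /andP[/ltW tj0 _] := htt (ltn_ord j).
  rewrite divr_ge0 ?D_ge0//.
  by have := D_ge0 w (ltW t0); rewrite /D e0 subr0.
rewrite (cond_prob_version_mul eta_m GT mC condT condN); last 2 first.
- by apply: filterS (nd_additive0_ae eta) => w; exact: f_ge0.
- move=> w; rewrite gE lee_fin.
  by rewrite !mulr_ge0 ?expR_ge0 ?exprn_ge0 ?(D_ge0 w (ltW t0)).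
rewrite -ge0_integralZl_EFin//; last 2 first.
- by move=> w _; rewrite lee_fin.
- exact/measurable_EFinP.
have mf : measurable_fun setT f.
  by move=> _ B mB; rewrite setTI; apply: eta_m; exact: condT.1.
have mg : measurable_fun setT g.
  by move=> _ B mB; rewrite setTI; apply: eta_m; exact: condN.1.
apply: ae_eq_integral => //.
- by apply: emeasurable_funM => //; apply: measurable_maxe.
- by apply: emeasurable_funM => //; exact/measurable_EFinP.
apply: filterS (nd_additive0_ae eta) => w e0 _.
rewrite (elimT max_idPl (f_ge0 w e0)) fE gE -!EFinM; congr EFin.
rewrite mulrCA; congr (_ * _); rewrite mulrA; congr (_ * _).
have -> : eta t w = D t w by rewrite /D e0 subr0.
rewrite big_split/= prodr_const card_ord exprVn.
(* Powers of [D t w] cancel only if it is nonzero. If it is zero, either [n = 0] and all the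
   products are 1, or monotonicity forces [D (tt 1) w = 0] and both sides vanish. *)
have [Dt0|Dt0] := eqVneq (D t w) 0; last by rewrite mulfVK// expf_neq0.
have [n0|n0] := posnP n.
  by rewrite n0 !expr0 invr1 !mulr1.
have -> : \prod_(j < n) D (tt j.+1) w = 0; last first.
  by rewrite Dt0 expr0n gtn_eqF// !mul0r.
have /andP[/ltW tj0 tjt] := htt n0.
rewrite (bigD1 (Ordinal n0))//= (_ : D (tt 1%N) w = 0) ?mul0r//.
apply/le_anti; rewrite D_ge0// andbT -Dt0 lerD2r.
exact: (nd_nondecreasing eta).
Qed.

Lemma integral_mixed_sample_ordered :
  (forall j, (j < n)%N -> tt j <= tt j.+1) ->
  (\int[P]_w (G w)%:E =
   \sum_(k : {ffun 'I_n -> 'I_n.+1} | admissible tt k)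
     ((\prod_(j < n)
         (((avail k j)`!%:R / ((k j)`!%:R * (avail k j - k j)`!%:R))%R%:E *
          'E_P[fun w => ((eta (tt j.+1) w - eta (tt j) w) ^+ k j *
                         expR (- (eta (tt j.+1) w - eta (tt j) w)))%R])) *
      'E_P[fun w => expR (- (eta t w - eta (tt n) w))%R]))%E.
Proof.
move=> tt_nd.
(* The partition is prolonged by the constant [t], so that [s] is nondecreasing on all indices and
   increment number [n] is the one from [tt n] to [t]. *)
pose s i := if (i <= n)%N then tt i else t.
have ttt i : (i <= n)%N -> tt i <= t.
  by case: i => [_|i /htt/andP[]//]; rewrite tt0 ltW.
have tt_ge0 i : (i <= n)%N -> 0 <= tt i.
  by case: i => [_|i /htt/andP[/ltW]//]; rewrite tt0.
have s_ge0 i : 0 <= s i by rewrite /s; case: ifPn => [/tt_ge0//|_]; exact: ltW.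
have s_nd i : s i <= s i.+1.
  rewrite /s; case: ltnP => [i_n|]; first by rewrite (ltnW i_n) tt_nd.
  by case: ifPn => // i_n _; exact: ttt.
have sE i : (i <= n)%N -> s i = tt i by rewrite /s => ->.
have sn1 : s n.+1 = t by rewrite /s ltnn.
pose X i w : R := eta (s i.+1) w - eta (s i) w.
have X_ge0 i w : 0 <= X i w by rewrite subr_ge0; apply: (nd_nondecreasing eta).
have mX i : measurable_fun setT (X i).
  by apply: measurable_funB; exact: measurable_nd_additive.
have DX m w : D (s m) w = \sum_(i < m) X i w.
  rewrite -(big_mkord xpredT (X^~ w)) (telescope_sumr (fun i => eta (s i) w))//.
  by rewrite /D (sE 0%N)// tt0.
(* The exponents are extended by 0: the increment after [tt n] contributes only its exponential. *)
pose e (k : {ffun 'I_n -> 'I_n.+1}) i : nat :=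
  if insub i is Some j then k j else 0%N.
have eE k (j : 'I_n) : e k j = k j by rewrite /e valK.
have en k : e k n = 0%N by rewrite /e insubF ?ltnn.
pose c (k : {ffun 'I_n -> 'I_n.+1}) : R :=
  \prod_(j < n) ((avail k j)`!%:R / ((k j)`!%:R * (avail k j - k j)`!%:R)).
have c_ge0 k : 0 <= c k.
  by apply: prodr_ge0 => j _; rewrite divr_ge0// mulr_ge0.
(* Truncating at 0 does not change the integrands, as increments are
   nonnegative. *)
pose g k i (y : R) : \bar R := (Num.max y 0 ^+ e k i * expR (- y))%:E.
have g_ge0 k i y : (0 <= g k i y)%E.
  by rewrite lee_fin mulr_ge0 ?expR_ge0// exprn_ge0// le_max lexx orbT.
have mg k i : measurable_fun setT (g k i).
  apply/measurable_EFinP; apply: measurable_funM; last first.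
    by apply: measurableT_comp => //; exact: measurableT_comp.
  by apply: measurable_funX; exact: measurable_maxr.
have gX k i w : g k i (X i w) = (X i w ^+ e k i * expR (- X i w))%:E.
  by rewrite /g max_l.
(* The exponential of [- D t w] splits over all [n.+1] increments, while the product of the partial
   sums expands over the first [n]. *)
have GE w : (G w)%:E = (\sum_(k | admissible tt k)
    (c k)%:E * \prod_(i < n.+1) g k i (X i w))%E.
  have -> : G w = \sum_(k | admissible tt k)
      c k * \prod_(i < n.+1) (X i w ^+ e k i * expR (- X i w)).
    rewrite /G -sn1 DX.
    under eq_bigr do rewrite -sE ?DX//.
    rewrite (@prod_partial_sums_admissible R n tt (X^~ w)); last first.
      by move=> j jn ttj; rewrite /X !sE ?ttj ?subrr// ltnW.
    rewrite mulr_suml; apply: eq_bigr => k _.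
    rewrite big_split/= -mulrA; congr (_ * _).
    rewrite [in RHS]big_split/= -expR_sum sumrN; congr (_ * _).
    rewrite big_ord_recr/= en expr0 mulr1.
    by apply: eq_bigr => j _; rewrite eE.
  rewrite -sumEFin; apply: eq_bigr => k _; rewrite EFinM.
  by congr (_ * _)%E; rewrite -prodEFin; apply: eq_bigr => i _; rewrite gX.
have mgX k i : measurable_fun setT (fun w => g k i (X i w)).
  exact: measurableT_comp.
under eq_integral do rewrite GE -big_filter.
rewrite ge0_integral_sum//; last 2 first.
- by move=> k; apply: measurable_funeM; exact: emeasurable_prod.
- by move=> k w _; rewrite mule_ge0 ?lee_fin ?c_ge0// prode_ge0.
rewrite big_filter; apply: eq_bigr => k _.
rewrite ge0_integralZl//; last 3 first.
- exact: emeasurable_prod.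
- by move=> w _; exact: prode_ge0.
- by rewrite lee_fin c_ge0.
(* Each summand is now a product of functions of distinct increments, to which independence
   applies. *)
rewrite (@integral_prod_independent _ _ _ _ _ P n.+1 X (g k))//; last first.
  have [_ _ _ indep _] := nd_additiveP eta.
  by move=> B mB; exact: (indep n.+1 s B (s_ge0 0%N) s_nd mB).
rewrite big_ord_recr/= muleA big_split/= prodEFin; congr (_ * _ * _)%E.
  apply: eq_bigr => j _; rewrite unlock; apply: eq_integral => w _.
  by rewrite gX eE /X !sE// ltnW.
rewrite unlock; apply: eq_integral => w _.
by rewrite gX en expr0 mul1r /X sn1 sE.
Qed.

End mixed_sample.

Theorem proposition2p6 (d : measure_display) (T : measurableType d)
    (R : realType) (P : probability T R)
    (eta : nd_additive P) (N : R -> T -> nat) (t : R) (T' : nat -> T -> R)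
    (hN : cox_process eta N) (ht : 0 < t)
    (hT' : nonordered_points eta N t T')
    (n : nat) (tt : nat -> R) (tt0 : tt 0%N = 0)
    (htt : forall j, (j < n)%N -> 0 < tt j.+1 <= t) :
  (P [set w | (forall j, (j < n)%N -> (T' j w <= tt j.+1)%R) /\ N t w = n] =
   (n`!%:R^-1)%:E *
   'E_P[fun w => ((\prod_(j < n) eta (tt j.+1) w) * expR (- eta t w))%R])%E
  /\
  ((forall j, (j < n)%N -> tt j <= tt j.+1) ->
   (P [set w | (forall j, (j < n)%N -> (T' j w <= tt j.+1)%R) /\ N t w = n] =
    (n`!%:R^-1)%:E *
    \sum_(k : {ffun 'I_n -> 'I_n.+1} | admissible tt k)
      ((\prod_(j < n)
          (((avail k j)`!%:R / ((k j)`!%:R * (avail k j - k j)`!%:R))%R%:E *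
           'E_P[fun w => ((eta (tt j.+1) w - eta (tt j) w) ^+ k j *
                          expR (- (eta (tt j.+1) w - eta (tt j) w)))%R])) *
       'E_P[fun w => expR (- (eta t w - eta (tt n) w))%R]))%E).
Proof.
have probE := prob_nonordered_points ht htt hN hT'.
split; first by rewrite probE expectation_prod_shift.
by move=> tt_nd; rewrite probE integral_mixed_sample_ordered.
Qed.
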